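(* Let $L$ be a finite-dimensional Lie algebra over $\mathbb{F}$. Then the perfect radical $P(L)$ of $L$ is equal to the smallest ideal of the derived series $L^{(0)}\supseteq L^{(1)}\supseteq L^{(2)}\supseteq\cdots$ of $L$.
   Context: $\mathbb{F}$ denotes either the field of real numbers or the field of complex numbers. An ideal $I$ of a Lie algebra $L$ is called a perfect ideal if $[I,I]=I$, where $[I,I]$ is the linear span of all brackets of elements of $I$; the zero ideal is a perfect ideal. The sum of two perfect ideals is a perfect ideal, so a finite-dimensional Lie algebra $L$ has a largest perfect ideal (one containing all perfect ideals of $L$); it is called the perfect radical of $L$ and denoted $P(L)$. The derived series of $L$ is the descending sequence of ideals $L^{(0)}=L$, $L^{(k+1)}=[L^{(k)},L^{(k)}]$; since $L$ is finite-dimensional it stabilizes, and its smallest ideal is its eventual constant value. *)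

(* Defs.v *)
From HB Require Import structures.
From mathcomp Require Import all_boot all_order all_algebra.
From mathcomp Require Import boolp reals.
From mathcomp Require Import complex.

Set Implicit Arguments.
Unset Strict Implicit.
Unset Printing Implicit Defensive.

Import GRing.Theory.
Local Open Scope ring_scope.

Variant scalars := RealScalars | ComplexScalars.

Definition scalar_field (R : realType) (s : scalars) : fieldType :=
  match s with
  | RealScalars => R
  | ComplexScalars => R[i]
  end.

HB.mixin Record Lmodule_isLie (K : fieldType) (L : Type)
    of GRing.Lmodule K L := {
  lie : L -> L -> L;
  lie_linearl : forall y : L, linear (fun x => lie x y);
  lie_linearr : forall x : L, linear (lie x);
  liexx : forall x : L, lie x x = 0;
  lie_jacobi : forall x y z : L,
    lie x (lie y z) + lie y (lie z x) + lie z (lie x y) = 0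
}.

#[short(type="lieAlgType")]
HB.structure Definition LieAlgebra (K : fieldType) :=
  {L of GRing.Lmodule K L & Lmodule_isLie K L}.

#[short(type="fdLieAlgType")]
HB.structure Definition FdLieAlgebra (K : fieldType) :=
  {L of Vector K L & Lmodule_isLie K L}.

HB.instance Definition _ (K : fieldType) (L : lieAlgType K) (x : L) :=
  GRing.isLinear.Build K L L _ (lie x) (lie_linearr x).

Section FdLie.
Context {K : fieldType} {L : fdLieAlgType K}.
Implicit Types (U V W I J P : {vspace L}) (x y z : L).

(* As for prodv, the span of all brackets [x, y] with x in U and y in V is
   computed on bases; mem_lie_span and lie_span_sub below show that it is the
   least subspace containing all these brackets. *)
Definition lie_span U V : {vspace L} :=
  <<[seq lie x y | x <- vbasis U, y <- vbasis V]>>%VS.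

Lemma mem_lie_span U V x y : x \in U -> y \in V -> lie x y \in lie_span U V.
Proof.
pose f z : L -> L := fun t => lie t z.
pose M z := GRing.isLinear.Build K L L _ (f z) (lie_linearl z).
pose g z : {linear L -> L} := HB.pack (f z) (M z).
move=> /coord_vbasis-> /coord_vbasis->; rewrite -[lie _ _]/(g _ _) linear_sum.
apply: memv_suml => i _; rewrite linearZ memvZ //= /f linear_sum.
apply: memv_suml => j _; rewrite linearZ memvZ //=.
by apply/memv_span/allpairs_f; rewrite mem_nth // size_tuple.
Qed.

Lemma lie_span_sub U V W :
  (forall x y, x \in U -> y \in V -> lie x y \in W) -> (lie_span U V <= W)%VS.
Proof.
move=> UVW; apply/span_subvP => _ /allpairsP[[x y] /= [xU yV ->]].
by apply: UVW; apply: vbasis_mem.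
Qed.

Definition lie_ideal I := forall x y, y \in I -> lie x y \in I.

Definition perfect_ideal I := lie_ideal I /\ lie_span I I = I.

Definition largest_perfect_ideal P :=
  perfect_ideal P /\ forall I, perfect_ideal I -> (I <= P)%VS.

Definition derived_series k : {vspace L} :=
  iter k (fun I => lie_span I I) fullv.

Definition smallest_derived I :=
  (exists k, I = derived_series k) /\ forall k, (I <= derived_series k)%VS.

Lemma lie_spanS U V U' V' :
  (U <= U' -> V <= V' -> lie_span U V <= lie_span U' V')%VS.
Proof.
move=> /subvP sU /subvP sV; apply: lie_span_sub => x y xU yV.
by apply: mem_lie_span; [apply: sU | apply: sV].
Qed.

Lemma perfect_ideal0 : perfect_ideal 0%VS.
Proof.
split=> [x y|]; first by rewrite memv0 => /eqP->; rewrite linear0 mem0v.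
apply/eqP; rewrite -subv0; apply: lie_span_sub => x y _.
by rewrite memv0 => /eqP->; rewrite linear0 mem0v.
Qed.

Lemma perfect_idealD I J :
  perfect_ideal I -> perfect_ideal J -> perfect_ideal (I + J)%VS.
Proof.
move=> [idI pI] [idJ pJ].
have idIJ : lie_ideal (I + J)%VS.
  move=> x _ /memv_addP[u uI [v vJ ->]]; rewrite linearD.
  by apply: memv_add; [apply: idI | apply: idJ].
split=> //; apply/eqP; rewrite eqEsubv; apply/andP; split.
  by apply: lie_span_sub => x y _; apply: idIJ.
by rewrite subv_add -{1}pI -{3}pJ !lie_spanS ?addvSl ?addvSr.
Qed.

Lemma largest_perfect_ideal_ex : exists P, largest_perfect_ideal P.
Proof.
pose A n := `[< exists2 I, perfect_ideal I & \dim I = n >].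
have exA : exists n, A n.
  by exists 0; apply/asboolP; exists 0%VS; [exact: perfect_ideal0 | exact: dimv0].
have leA n : A n -> (n <= \dim {:L})%N.
  by move=> /asboolP[I _ <-]; rewrite dimvS ?subvf.
case: (ex_maxnP exA leA) => n /asboolP[P pP dP] maxn; exists P; split=> // I pI.
have /maxn : A (\dim (P + I)%VS).
  by apply/asboolP; exists (P + I)%VS => //; apply: perfect_idealD.
rewrite -dP => le; have /eqP-> : P == (P + I)%VS by rewrite eqEdim addvSl.
exact: addvSr.
Qed.

Lemma smallest_derived_ex : exists I, smallest_derived I.
Proof.
pose A n := `[< exists k, \dim (derived_series k) = n >].
have exA : exists n, A n by exists (\dim (derived_series 0)); apply/asboolP; exists 0.
have desc k m : (derived_series (m + k) <= derived_series k)%VS.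
  elim: m => [|m IH]; first exact: subvv.
  apply: subv_trans IH; rewrite addSn.
  elim: (m + k)%N => [|j IHj]; first exact: subvf.
  exact: (lie_spanS IHj IHj).
case: (ex_minnP exA) => n /asboolP[k dk] minn.
exists (derived_series k); split=> [|m]; first by exists k.
suff -> : derived_series k = derived_series (m + k).
  by rewrite addnC desc.
apply/esym/eqP; rewrite eqEdim desc dk minn //.
by apply/asboolP; exists (m + k)%N.
Qed.

End FdLie.

Definition perfect_radical (K : fieldType) (L : fdLieAlgType K) : {vspace L} :=
  sval (cid (@largest_perfect_ideal_ex K L)).

Lemma perfect_radicalP (K : fieldType) (L : fdLieAlgType K) :
  largest_perfect_ideal (perfect_radical L).
Proof. exact: svalP. Qed.

Definition derived_series_min (K : fieldType) (L : fdLieAlgType K) : {vspace L} :=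
  sval (cid (@smallest_derived_ex K L)).

Lemma derived_series_minP (K : fieldType) (L : fdLieAlgType K) :
  smallest_derived (derived_series_min L).
Proof. exact: svalP. Qed.

(* Main.v *)
Require Import Defs.
From HB Require Import structures.
From mathcomp Require Import all_boot all_order all_algebra.
From mathcomp Require Import boolp reals.
From mathcomp Require Import complex.

(** Each inclusion uses the maximality or minimality of one side.  By the Jacobi
    identity every term of the derived series is an ideal
    ([lie_ideal_derived_series]); the last one is an ideal that the derivation
    [I |-> [I, I]] cannot shrink, so it is perfect and lies in the perfect
    radical.  Conversely, a perfect ideal [I = [I, I]] passes unchanged through
    each derivation step, so the inclusion of [I] in [L] descends to every term
    of the series ([perfect_ideal_sub_derived]). *)

Import GRing.Theory.
Local Open Scope ring_scope.

Lemma lie_antisym {K : fieldType} {L : fdLieAlgType K} (x y : L) :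
  lie x y = - lie y x.
Proof.
have lieDl (u v w : L) : lie (u + v) w = lie u w + lie v w.
  by have := lie_linearl w 1 u v; rewrite /= !scale1r.
apply/eqP; rewrite -addr_eq0; apply/eqP.
by have := liexx (x + y); rewrite lieDl !linearD /= !liexx add0r addr0.
Qed.

(** The Jacobi identity makes [lie x] a derivation, so
    [[x, [a, b]] = [a, [x, b]] - [b, [x, a]]] is again a combination of brackets
    of elements of [I]. *)
Lemma lie_ideal_lie_span {K : fieldType} {L : fdLieAlgType K} (I : {vspace L}) :
  lie_ideal I -> lie_ideal (lie_span I I).
Proof.
move=> idI x z zII.
(* Membership of [lie x z] is linear in z, hence need only be tested on
   brackets: they are to lie in the preimage of [lie_span I I] by [lie x]. *)
suff /subvP/(_ z zII) :
    (lie_span I I <= linfun (lie x) @^-1: lie_span I I)%VS.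
  by rewrite -memv_preim lfunE.
apply: lie_span_sub => a b aI bI; rewrite -memv_preim lfunE /=.
have -> : lie x (lie a b) = lie a (lie x b) - lie b (lie x a).
  have := lie_jacobi x a b; rewrite (lie_antisym b x) linearN /= => /eqP.
  by rewrite -addrA addr_eq0 opprD opprK => /eqP.
by apply: memvB; apply: mem_lie_span => //; apply: idI.
Qed.

Lemma lie_ideal_derived_series {K : fieldType} {L : fdLieAlgType K} (k : nat) :
  lie_ideal (@derived_series K L k).
Proof.
elim: k => [x y _|k IHk]; first exact: memvf.
exact: lie_ideal_lie_span.
Qed.

Lemma perfect_ideal_sub_derived {K : fieldType} {L : fdLieAlgType K}
    (I : {vspace L}) (k : nat) :
  perfect_ideal I -> (I <= derived_series k)%VS.
Proof.
move=> [_ pI]; elim: k => [|k IHk]; first exact: subvf.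
by rewrite -pI; apply: lie_spanS.
Qed.

(** Minimality against the successor term [D_(k+1) = [D_k, D_k]] gives
    [D_k <= [D_k, D_k]]; the other inclusion holds because [D_k] is an ideal. *)
Lemma perfect_ideal_smallest_derived {K : fieldType} {L : fdLieAlgType K}
    (I : {vspace L}) :
  smallest_derived I -> perfect_ideal I.
Proof.
move=> [[k ->] minI]; have idD := lie_ideal_derived_series (L := L) k.
split=> //; apply/eqP; rewrite eqEsubv (minI k.+1) andbT.
by apply: lie_span_sub => x y _; apply: idD.
Qed.

Lemma largest_perfect_eq_smallest_derived {K : fieldType}
    {L : fdLieAlgType K} (P D : {vspace L}) :
  largest_perfect_ideal P -> smallest_derived D -> P = D.
Proof.
move=> [pP maxP] minD; apply/eqP; rewrite eqEsubv; apply/andP; split.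
  by case: minD => [[k ->] _]; apply: perfect_ideal_sub_derived.
by apply: maxP; apply: perfect_ideal_smallest_derived.
Qed.

Theorem proposition2p3 (R : realType) (s : scalars)
    (L : fdLieAlgType (scalar_field R s)) :
  perfect_radical L = derived_series_min L.
Proof.
exact: (largest_perfect_eq_smallest_derived _ _ (perfect_radicalP L)
          (derived_series_minP L)).
Qed.
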